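(* The Nica spectrum $\Omega$ of $\mathbb N\rtimes\mathbb N^\times$ is $$\Omega=\{A(k,M):M\in\mathcal N,\ k\in\mathbb N\}\cup\{B(r,N):N\in\mathcal N,\ r\in\mathbb Z/N\}.$$
   Context: $\mathbb N=\{0,1,2,\dots\}$; $\mathbb N^\times$ is the multiplicative semigroup of positive integers; $\mathbb N\rtimes\mathbb N^\times$ has product $(m,a)(n,b)=(m+an,ab)$ and partial order $(m,a)\le(n,b)\iff a^{-1}(n-m)\in\mathbb N$ and $a^{-1}b\in\mathbb N^\times$. The Nica spectrum $\Omega$ is the set of nonempty subsets $\omega\subset\mathbb N\rtimes\mathbb N^\times$ that are hereditary ($x\le y\in\omega$, $x\in\mathbb N\rtimes\mathbb N^\times$ imply $x\in\omega$) and directed (any two elements of $\omega$ have a common upper bound in $\omega$). $\mathcal N$ is the set of supernatural numbers, i.e. formal products $N=\prod_{p}p^{e_p(N)}$ over all primes with exponents $e_p(N)\in\mathbb N\cup\{\infty\}$; $M\mid N$ means $e_p(M)\le e_p(N)$ for all $p$. For $N\in\mathcal N$, $\mathbb Z/N:=\varprojlim\{\mathbb Z/a\mathbb Z:a\in\mathbb N^\times,\ a\mid N\}$; for $a\mid N$ and $r\in\mathbb Z/N$, $r(a)\in\mathbb Z/a\mathbb Z$ is the image of $r$, viewed as a residue class of integers. For $k\in\mathbb N$, $N\in\mathcal N$ and $r\in\mathbb Z/N$, $$A(k,N):=\{(m,a)\in\mathbb N\rtimes\mathbb N^\times:a\mid N\text{ and }a^{-1}(k-m)\in\mathbb N\},$$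 $$B(r,N):=\{(m,a)\in\mathbb N\rtimes\mathbb N^\times:a\mid N\text{ and }m\in r(a)\}.$$ *)

(* Defs.v *)
From HB Require Import structures.
From mathcomp Require Import all_boot all_order all_algebra.
From mathcomp Require Import all_classical.

Set Implicit Arguments.
Unset Strict Implicit.
Unset Printing Implicit Defensive.

Import Order.TTheory GRing.Theory Num.Theory.
Local Open Scope classical_set_scope.
Local Open Scope ring_scope.

(* The multiplicative semigroup N^x of positive integers. *)
Record posnat := PosNat { posnat_val :> nat; _ : (0 < posnat_val)%N }.

HB.instance Definition _ := [isSub for posnat_val].
HB.instance Definition _ := [Choice of posnat by <:].

Lemma posnat_gt0 (a : posnat) : (0 < a)%N.
Proof. by case: a. Qed.

Lemma posnat_mul_gt0 (a b : posnat) : (0 < a * b)%N.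
Proof. by rewrite muln_gt0 !posnat_gt0. Qed.

Definition posnat_mul (a b : posnat) : posnat := PosNat (posnat_mul_gt0 a b).

(* The semidirect product of N by N^x. *)
Definition affN : Type := (nat * posnat)%type.

Definition affN_mul (x y : affN) : affN :=
  ((x.1 + x.2 * y.1)%N, posnat_mul x.2 y.2).

(* Both quotients are computed in the field of rationals. *)
Definition affN_le (x y : affN) : Prop :=
  ((x.2%:R : rat)^-1 * (y.1%:R - x.1%:R) \is a Num.nat) /\
  ((x.2%:R : rat)^-1 * y.2%:R \is a Num.nat /\
   0 < (x.2%:R : rat)^-1 * y.2%:R).

Lemma affN_divE (a : posnat) (m n : nat) :
  (a%:R : rat)^-1 * (n%:R - m%:R) \is a Num.nat
  <-> exists c : nat, n = (m + a * c)%N.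
Proof.
have a0 : (a%:R : rat) != 0 by rewrite pnatr_eq0 -lt0n posnat_gt0.
split=> [/natrP[c E]|[c ->]]; last first.
  by rewrite natrD addrC addKr natrM mulKf.
exists c; apply/eqP; rewrite -(eqr_nat rat) natrD natrM -E mulVKf //.
by rewrite addrC subrK.
Qed.

(* The order is left divisibility for the product. *)
Lemma affN_leE (x y : affN) : affN_le x y <-> exists z, y = affN_mul x z.
Proof.
case: x y => [m a] [n b]; split=> [[/affN_divE[c /= ->]] []|[[c d] [-> ->]]].
  rewrite -[X in _ * X](subr0 b%:R) => /(affN_divE a 0)[d /= E] _.
  have d0 : (0 < d)%N.
    by have := posnat_gt0 b; rewrite E add0n muln_gt0 => /andP[].
  by exists (c, PosNat d0); congr pair; apply: val_inj.
have a0 : (a%:R : rat) != 0 by rewrite pnatr_eq0 -lt0n posnat_gt0.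
split=> /=; first by apply/affN_divE; exists c.
by rewrite natrM mulKf // natr_nat ltr0n posnat_gt0.
Qed.

Definition hereditary (w : set affN) : Prop :=
  forall x y : affN, affN_le x y -> w y -> w x.

Definition directed (w : set affN) : Prop :=
  forall x y : affN, w x -> w y ->
    exists z : affN, [/\ w z, affN_le x z & affN_le y z].

Definition Nica_spectrum : set (set affN) :=
  [set w | [/\ w !=set0, hereditary w & directed w]].

(* Exponents of supernatural numbers; [None] stands for infinity. *)
Definition xnat_le (m n : option nat) : bool :=
  match m, n with
  | _, None => true
  | None, Some _ => false
  | Some i, Some j => (i <= j)%N
  end.

Definition supernat : Type := {p : nat | prime p} -> option nat.

Definition supernat_of (a : posnat) : supernat :=
  fun p => Some (logn (val p) a).

Definition sdvd (M N : supernat) : Prop := forall p, xnat_le (M p) (N p).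

(* Z/aZ as the set 'I_a of least nonnegative representatives; 'Z_a would be
   wrong for a = 1. The transition map Z/b -> Z/a, for a dividing b, is
   reduction modulo a. *)
Record Zmod (N : supernat) := MkZmod {
  Zmod_proj :> forall a : posnat, sdvd (supernat_of a) N -> 'I_a;
  Zmod_compat : forall (a b : posnat) (aN : sdvd (supernat_of a) N)
      (bN : sdvd (supernat_of b) N),
    (a %| b)%N -> (Zmod_proj bN %% a)%N = Zmod_proj aN }.

Definition residue_class (a : nat) (c : 'I_a) : set int :=
  [set z : int | (z = (c : nat)%:Z %[mod a%:Z])%Z].

Definition Aset (k : nat) (N : supernat) : set affN :=
  [set x : affN | sdvd (supernat_of x.2) N /\
    (x.2%:R : rat)^-1 * (k%:R - x.1%:R) \is a Num.nat].

Definition Bset (N : supernat) (r : Zmod N) : set affN :=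
  [set x : affN | exists aN : sdvd (supernat_of x.2) N,
    residue_class (r x.2 aN) x.1%:Z].

(* Main.v *)
(** In a directed hereditary set [w], the second coordinates are closed under
divisors and common multiples, so they are the divisors of a supernatural
number [N], and the first coordinates paired with multiples of [a] all agree
modulo [a]. If the first coordinates are bounded, with maximum [k], then every
element of [w] lies below some [(k, b)], and [w] is [A(k, N)]. Otherwise the
residues define [r] in [Z/N], and [w] is [B(r, N)] because large first
coordinates place every [(m, a)] with [a | N] and [m] in [r(a)] below an
element of [w]. *)

From mathcomp Require Import all_boot all_order all_algebra.
From mathcomp Require Import all_classical.
Require Import Defs.
Local Open Scope classical_set_scope.

Lemma modn_dvd_congr {a b m n : nat} :
  a %| b -> m = n %[mod b] -> m = n %[mod a].
Proof. by move=> ab E; rewrite -(modn_dvdm m ab) E modn_dvdm. Qed.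

Lemma exists_add_mul_iff (a m n : nat) :
  (exists c, n = m + a * c) <-> m <= n /\ n = m %[mod a].
Proof.
split=> [[c ->]|[mn /eqP]].
  by split; [exact: leq_addr | rewrite mulnC addnC modnMDl].
by rewrite eqn_mod_dvd// => /dvdnP[c E]; exists c; rewrite mulnC -E subnKC.
Qed.

(** A form of the order free of rational quotients, so that all later comparisons are inequalities,
    congruences and divisibilities of naturals. *)
Lemma affN_leP (x y : affN) :
  affN_le x y <-> [/\ x.1 <= y.1, y.1 = x.1 %[mod x.2] & x.2 %| y.2].
Proof.
split=> [xy|[le_xy mod_xy /dvdnP[d E]]].
  case: (xy) => /affN_divE/exists_add_mul_iff[le_xy mod_xy] _; split=> //.
  by move/affN_leE: xy => [z ->]; exact: dvdn_mulr.
have [c Ec] : exists c, y.1 = x.1 + x.2 * c by exact/exists_add_mul_iff.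
have d0 : 0 < d by have := posnat_gt0 y.2; rewrite E muln_gt0 => /andP[].
apply/affN_leE; exists (c, PosNat d0); case: y Ec E {le_xy mod_xy} => n b /= -> E.
by congr pair; apply: val_inj; rewrite /= E mulnC.
Qed.

Lemma AsetP (k : nat) (N : supernat) (x : affN) :
  Aset k N x <->
  [/\ sdvd (supernat_of x.2) N, x.1 <= k & k = x.1 %[mod x.2]].
Proof.
split=> [[xN /affN_divE/exists_add_mul_iff[]]|[xN xk kx]] //.
by split=> //; apply/affN_divE/exists_add_mul_iff.
Qed.

Lemma BsetP (N : supernat) (r : Zmod N) (x : affN) :
  Bset r x <-> exists aN : sdvd (supernat_of x.2) N, r x.2 aN = x.1 %% x.2 :> nat.
Proof.
split=> -[aN]; rewrite /residue_class /= => E; exists aN.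
  by move: E; rewrite !modz_nat (modn_small (ltn_ord _)) => -[].
by rewrite /residue_class /= !modz_nat E modn_mod.
Qed.

Lemma sdvd_dvdn {N : supernat} {a b : posnat} :
  a %| b -> sdvd (supernat_of b) N -> sdvd (supernat_of a) N.
Proof.
move=> ab bN p; have := bN p; rewrite /supernat_of /=; case: (N p) => //= i.
exact/leq_trans/dvdn_leq_log/ab/posnat_gt0.
Qed.

Lemma posnat_lcm_gt0 (a b : posnat) : 0 < lcmn a b.
Proof. by rewrite lcmn_gt0 !posnat_gt0. Qed.

Definition posnat_lcm (a b : posnat) : posnat := PosNat (posnat_lcm_gt0 a b).

Lemma sdvd_lcm (N : supernat) (a b : posnat) :
  sdvd (supernat_of a) N -> sdvd (supernat_of b) N ->
  sdvd (supernat_of (posnat_lcm a b)) N.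
Proof.
move=> aN bN p; have := aN p; have := bN p; rewrite /supernat_of /=.
case: (N p) => //= i pa pb.
by rewrite logn_lcm ?posnat_gt0// geq_max pb.
Qed.

Lemma sdvd1 (N : supernat) (l : 0 < 1) : sdvd (supernat_of (PosNat l)) N.
Proof. by move=> p; rewrite /supernat_of /= logn1; case: (N p). Qed.

(** Directedness holds because [k] serves as first coordinate of every upper bound, paired with the
    lcm of the second coordinates. *)
Lemma Aset_spectrum (k : nat) (N : supernat) : Nica_spectrum (Aset k N).
Proof.
split.
- by exists (k, PosNat (ltn0Sn 0)); apply/AsetP; split=> //; exact: sdvd1.
- move=> x y /affN_leP[xy yx dxy] /AsetP[yN yk ky]; apply/AsetP; split.
  + exact: sdvd_dvdn dxy yN.
  + exact: leq_trans yk.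
  + by rewrite (modn_dvd_congr dxy ky).
- move=> x y /AsetP[xN xk kx] /AsetP[yN yk ky].
  exists (k, posnat_lcm x.2 y.2); split.
  + by apply/AsetP; split=> //; exact: sdvd_lcm.
  + by apply/affN_leP; split=> //; exact: dvdn_lcml.
  + by apply/affN_leP; split=> //; exact: dvdn_lcmr.
Qed.

Lemma Bset_spectrum (N : supernat) (r : Zmod N) : Nica_spectrum (Bset r).
Proof.
split.
- exists (0, PosNat (ltn0Sn 0)); apply/BsetP; exists (sdvd1 N (ltn0Sn 0)).
  by rewrite ord1.
- move=> x y /affN_leP[xy yx dxy] /BsetP[yN ry].
  apply/BsetP; exists (sdvd_dvdn dxy yN).
  by rewrite -(Zmod_compat r (sdvd_dvdn dxy yN) yN dxy) ry modn_dvdm.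
- move=> x y /BsetP[xN rx] /BsetP[yN ry].
  pose c := posnat_lcm x.2 y.2; have cN := sdvd_lcm N x.2 y.2 xN yN.
  (* A representative of the class of [r] modulo [c], shifted by a multiple of [c] to lie above both
     first coordinates. *)
  pose k := (x.1 + y.1) * c + r c cN.
  have le_k : x.1 + y.1 <= k.
    by rewrite (leq_trans _ (leq_addr _ _))// leq_pmulr// posnat_gt0.
  have modk (z : affN) (zN : sdvd (supernat_of z.2) N) :
      r z.2 zN = z.1 %% z.2 :> nat -> z.2 %| c -> k = z.1 %[mod z.2].
    move=> rz dz; rewrite -rz -(Zmod_compat r zN cN dz).
    by apply: modn_dvd_congr dz _; rewrite modnMDl.
  exists (k, c); split.
  + by apply/BsetP; exists cN; rewrite /= modnMDl modn_small.
  + apply/affN_leP; split; rewrite /= ?dvdn_lcml//.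
      exact: leq_trans (leq_addr _ _) le_k.
    exact/modk/dvdn_lcml/rx.
  + apply/affN_leP; split; rewrite /= ?dvdn_lcmr//.
      exact: leq_trans (leq_addl _ _) le_k.
    exact/modk/dvdn_lcmr/ry.
Qed.

(** [e] is the supremum of [S], described by the naturals below it: a maximum if [S] is bounded,
    infinity otherwise. Nonemptiness is needed since 0 is below every [e]. *)
Lemma xnat_sup_exists (S : set nat) : S !=set0 ->
  exists e : option nat, forall i,
    xnat_le (Some i) e <-> exists2 j, S j & i <= j.
Proof.
move=> [s Ss]; have [[n Sn]|unbounded] := pselect (exists n, forall j, S j -> j <= n).
  pose P := [pred i | `[< exists2 j, S j & i <= j >]].
  have exP : exists i, P i by exists s; apply/asboolP; exists s.
  have ubP i : P i -> i <= n.
    by move=> /asboolP[j Sj ij]; exact: leq_trans ij (Sn j Sj).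
  case: (ex_maxnP exP ubP) => e /asboolP[j Sj ej] eP.
  exists (Some e) => i; split=> [ie|Pi]; last by apply: eP; exact/asboolP.
  by exists j => //; exact: leq_trans ej.
exists None => i; split=> // _; apply: contrapT => noj; apply: unbounded.
exists i => j Sj; rewrite leqNgt; apply/negP => ij.
by apply: noj; exists j => //; exact: ltnW.
Qed.

Section Directed.
Variable w : set affN.
Hypotheses (w0 : w !=set0) (wher : hereditary w) (wdir : directed w).

(** The first coordinate of a common upper bound is congruent to [m] modulo [a] and to [n] modulo
    [b]. *)
Lemma directed_congr (m n : nat) (a b : posnat) :
  w (m, a) -> w (n, b) -> a %| b -> n = m %[mod a].
Proof.
move=> wm wn ab.
have [k [_ /affN_leP[_ <- _] /affN_leP[_ kn _]]] := wdir _ _ wm wn.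
by rewrite (modn_dvd_congr ab kn).
Qed.

(** Only finitely many primes divide [a], so directedness merges their separate witnesses into one,
    by induction on a list of primes. *)
Lemma directed_dvd (a : nat) : 0 < a ->
  (forall p, prime p -> exists2 y, w y & logn p a <= logn p y.2) ->
  exists2 y, w y & a %| y.2.
Proof.
move=> a0 logw.
suff key (s : seq nat) : all prime s ->
    exists2 y, w y & {in s, forall p, logn p a <= logn p y.2}.
  have [|y wy leay] := key (primes a).
    by apply/allP => p; rewrite mem_primes => /andP[].
  exists y => //; apply/dvdn_partP => // p; rewrite /= => pa.
  rewrite p_part pfactor_dvdn ?posnat_gt0 ?leay//.
  by move: pa; rewrite mem_primes => /andP[].
elim: s => [_|p s IH /= /andP[pp /IH[y wy leay]]].
  by case: w0 => y wy; exists y.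
have [z wz leaz] := logw p pp.
have [t [wt /affN_leP[_ _ yt] /affN_leP[_ _ zt]]] := wdir _ _ wy wz.
exists t => // q; rewrite inE => /predU1P[->|qs].
  exact/(leq_trans leaz)/dvdn_leq_log/zt/posnat_gt0.
exact/(leq_trans (leay q qs))/dvdn_leq_log/yt/posnat_gt0.
Qed.

(** The exponent of [N] at [p] is the supremum of the [p]-adic valuations of the second coordinates
    in [w]. *)
Lemma directed_supernat :
  exists N, forall a, sdvd (supernat_of a) N <-> exists m, w (m, a).
Proof.
have /choice[N NP] : forall p : {p : nat | prime p}, exists e, forall i,
    xnat_le (Some i) e <->
    exists2 j, [set logn (val p) y.2 | y in w] j & i <= j.
  by move=> p; apply: xnat_sup_exists; case: w0 => y wy; exists (logn (val p) y.2), y.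
exists N => a; split=> [aN|[m wm] p]; last first.
  by apply/NP; exists (logn (val p) a) => //; exists (m, a).
have [|[n b] wy /= ab] := directed_dvd a (posnat_gt0 a).
  move=> p pp; have /NP[_ [y wy <-]] := aN (exist _ p pp); by exists y.
(* Keeping the first coordinate, [(n, a)] lies below [(n, b)] as [a] divides [b]. *)
by exists n; apply: (wher _ _ _ wy); apply/affN_leP.
Qed.

End Directed.

Theorem corollary5p6 :
  Nica_spectrum =
    [set w : set affN | exists (M : supernat) (k : nat), w = Aset k M] `|`
    [set w : set affN | exists (N : supernat) (r : Zmod N), w = Bset r].
Proof.
apply/seteqP; split=> [w [w0 wher wdir]|w]; last first.
  by case=> [[M [k ->]]|[N [r ->]]]; [exact: Aset_spectrum|exact: Bset_spectrum].
have [N NP] := directed_supernat w w0 wher wdir.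
have [[k wk]|unbounded] := pselect (exists k, forall x, w x -> x.1 <= k).
  left; pose P := [pred m | `[< exists a, w (m, a) >]].
  have exP : exists m, P m by case: w0 => -[m a] wx; exists m; apply/asboolP; exists a.
  have ubP m : P m -> m <= k by move=> /asboolP[a /wk].
  case: (ex_maxnP exP ubP) => {wk ubP exP}k /asboolP[b wkb] kmax.
  (* A common upper bound of [x] and [(k, b)] has first coordinate at least [k], hence equal to [k]
     by maximality. *)
  have below x : w x -> exists2 c, w (k, c) & affN_le x (k, c).
    move=> wx; have [[m c] [wz xz /affN_leP[/= km _ _]]] := wdir _ _ wx wkb.
    suff E : m = k by subst m; exists c.
    by apply/eqP; rewrite eqn_leq km andbT kmax//; apply/asboolP; exists c.
  exists N, k; apply/seteqP; split=> -[m a].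
    move=> wx; have [c _ /affN_leP[mk kx _]] := below _ wx.
    by apply/AsetP; split=> //; apply/NP; exists m.
  move=> /AsetP[/= /NP[n /below[c wc /affN_leP[_ _ ac]]] mk km].
  by apply: (wher _ _ _ wc); apply/affN_leP.
right.
(* An arbitrary first coordinate paired with [a]; by [directed_congr] its residue modulo [a] does
   not depend on the choice. *)
pose m_ (a : posnat) (aN : sdvd (supernat_of a) N) := sval (cid ((NP a).1 aN)).
have m_P a aN : w (m_ a aN, a) by exact: svalP (cid ((NP a).1 aN)).
pose r_ (a : posnat) (aN : sdvd (supernat_of a) N) : 'I_a :=
    Ordinal (ltn_pmod (m_ a aN) (posnat_gt0 a)).
have r_compat (a b : posnat) (aN : sdvd (supernat_of a) N)
    (bN : sdvd (supernat_of b) N) : a %| b -> r_ b bN %% a = r_ a aN.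
  by move=> ab; rewrite /= modn_dvdm//; apply: (directed_congr w) ab.
exists N, (MkZmod r_compat); apply/seteqP; split=> -[m a].
  move=> wx; have aN : sdvd (supernat_of a) N by apply/NP; exists m.
  by apply/BsetP; exists aN; exact: (directed_congr w wdir _ _ _ _ wx).
move=> /BsetP[/= aN ra].
have [y wy my] : exists2 y, w y & m <= y.1.
  apply: contrapT => noy; apply: unbounded; exists m => x wx.
  by rewrite leqNgt; apply/negP => mx; apply: noy; exists x => //; exact: ltnW.
(* [y] makes [z.1] at least [m], while [(m_ a aN, a)] gives [z.1] the residue of [m] modulo [a] and
   makes [a] divide [z.2]; so [(m, a)] lies below [z]. *)
have [z [wz /affN_leP[yz _ _] /affN_leP[_ /= za az]]] := wdir _ _ wy (m_P a aN).
apply: (wher _ _ _ wz); apply/affN_leP; split=> //=; first exact: leq_trans yz.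
by rewrite za ra.
Qed.
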